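(* For every integer $n\ge 0$, there is a bijection between the set of isomorphism classes of minimal set covers of an $n$-element set and the set of isomorphism classes of bipartite posets on $n$ elements which maps unbalanced minimal set covers to unbalanced bipartite posets and balanced minimal set covers to balanced bipartite posets.
   Context: A set cover of a finite set $V$ is a collection $\mathcal{C}$ of subsets of $V$ whose union is $V$; it is minimal if no member is contained in the union of the others. A minimal set cover is unbalanced if it contains a set of cardinality $|V|-|\mathcal{C}|+1$, and balanced otherwise. Set covers are identified under bijections of ground sets carrying members onto members. A bipartite poset is a finite poset of height at most one (no $x\prec y\prec z$). An element $v$ has height 1 if some $u\prec v$, height 0 otherwise; a height-0 element is a full support point if it is comparable to every height-1 element. A bipartite poset is unbalanced if it has a full support point and balanced otherwise. Posets are considered up to isomorphism. *)

(* Defs.v *)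
From mathcomp Require Import all_boot all_fingroup.

Set Implicit Arguments.
Unset Strict Implicit.
Unset Printing Implicit Defensive.

Section SetCovers.
Variable V : finType.
Implicit Types C D : {set {set V}}.

Definition is_set_cover C : bool := cover C == [set: V].

Definition is_min_cover C : bool :=
  is_set_cover C && [forall S in C, ~~ (S \subset cover (C :\ S))].

(* #|S| = #|V| - #|C| + 1, written without truncated subtraction. *)
Definition cover_unbalanced C : bool :=
  [exists S in C, #|S| + #|C| == #|V| + 1].

Definition cover_balanced C : bool := ~~ cover_unbalanced C.

Definition cover_iso : rel {set {set V}} := fun C D =>
  [exists s : {perm V}, D == [set s @: S | S : {set V} in C]].

Definition min_cover_classes : {set {set {set {set V}}}} :=
  equivalence_partition cover_iso [set C | is_min_cover C].

Lemma cover_iso_equiv : equivalence_rel cover_iso.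
Proof.
have imM (s t : {perm V}) C :
    [set (s * t)%g @: S | S : {set V} in C] =
    [set t @: S | S : {set V} in [set s @: S | S : {set V} in C]].
  rewrite -imset_comp; apply: eq_imset => S /=.
  by rewrite -imset_comp; apply: eq_imset => x; rewrite permM.
have im1 C : [set (1 : {perm V})%g @: S | S : {set V} in C] = C.
  rewrite -[RHS]imset_id; apply: eq_imset => S.
  by rewrite -[RHS]imset_id; apply: eq_imset => x; rewrite perm1.
move=> C D E; split; first by apply/existsP; exists 1%g; rewrite im1.
case/existsP=> s /eqP ->; apply/existsP/existsP=> -[t /eqP ->].
  by exists (s^-1 * t)%g; rewrite -imM mulKVg.
by exists (s * t)%g; rewrite imM.
Qed.

End SetCovers.

Section BipartitePosets.
Variable T : finType.
(* A binary relation on T is the set of pairs (x, y) with x below y. *)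
Implicit Types r q : {set T * T}.

Definition ple r : rel T := fun x y => (x, y) \in r.
Definition plt r : rel T := fun x y => (x != y) && ple r x y.

Definition is_poset r : bool :=
  [&& [forall x, ple r x x],
      [forall x, forall y, ple r x y && ple r y x ==> (x == y)] &
      [forall x, forall y, forall z, ple r x y && ple r y z ==> ple r x z]].

Definition is_bipartite_poset r : bool :=
  is_poset r &&
  ~~ [exists x, exists y, exists z, plt r x y && plt r y z].

Definition height1 r (v : T) : bool := [exists u, plt r u v].
Definition height0 r (v : T) : bool := ~~ height1 r v.

Definition full_support_point r (u : T) : bool :=
  height0 r u && [forall v, height1 r v ==> ple r u v || ple r v u].

Definition poset_unbalanced r : bool := [exists u, full_support_point r u].
Definition poset_balanced r : bool := ~~ poset_unbalanced r.

Definition poset_iso : rel {set T * T} := fun r q =>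
  [exists s : {perm T}, forall x, forall y, ple r x y == ple q (s x) (s y)].

Definition bipartite_poset_classes : {set {set {set T * T}}} :=
  equivalence_partition poset_iso [set r | is_bipartite_poset r].

Lemma is_posetP r :
  reflect [/\ reflexive (ple r), antisymmetric (ple r) & transitive (ple r)]
          (is_poset r).
Proof.
apply: (iffP and3P) => -[].
  move=> /forallP h1 /'forall_forallP h2 /forallP h3; split=> //.
    by move=> x y xy; apply/eqP; exact: (implyP (h2 x y)).
  move=> y x z xy yz; have /'forall_forallP h := h3 x.
  by apply: (implyP (h y z)); rewrite xy.
move=> h1 h2 h3; split; first exact/forallP.
  by apply/'forall_forallP=> x y; apply/implyP=> /h2 ->.
apply/forallP=> x; apply/'forall_forallP=> y z.
by apply/implyP=> /andP[]; exact: h3.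
Qed.

Lemma poset_iso_equiv : equivalence_rel poset_iso.
Proof.
move=> r q p; split.
  by apply/existsP; exists 1%g; apply/'forall_forallP=> x y; rewrite !perm1.
case/existsP=> s /'forall_forallP rq.
apply/existsP/existsP=> -[t /'forall_forallP h].
  exists (s^-1 * t)%g; apply/'forall_forallP=> x y; rewrite !permM.
  by rewrite -(eqP (h _ _)) (eqP (rq _ _)) !permKV.
exists (s * t)%g; apply/'forall_forallP=> x y; rewrite !permM.
by rewrite -(eqP (h _ _)) (eqP (rq _ _)).
Qed.

End BipartitePosets.

(* Main.v *)
(** A bipartite poset is sent to the collection of the principal up-sets of its
    height-0 elements. This is a minimal cover, because a height-0 element lies
    in no up-set but its own. Conversely, choosing one private point in each
    member of a minimal cover and putting it below all points of that member
    gives a bipartite poset. Two choices of private points differ by a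
    permutation that preserves membership in every member of the cover, so the
    poset is determined up to isomorphism. With k members, a member has n - k + 1
    points exactly when it contains everything except the k - 1 other chosen
    points, that is, when its chosen point is a full support point. *)
Require Import Defs.
From mathcomp Require Import all_boot all_fingroup.

Set Implicit Arguments.
Unset Strict Implicit.
Unset Printing Implicit Defensive.

(** * Bijections between quotients *)

(** A map [G] on representatives that preserves and reflects equivalence and meets every class pulls
    classes back to classes; [f] is this preimage map. The last clause lets properties of
    representatives be carried along [f]. *)
Lemma equivalence_partition_bij (T T' : finType) (R : rel T) (Q : rel T')
    (D : {set T}) (E : {set T'}) (G : T' -> T) :
    equivalence_rel R ->
    {in E, forall r, G r \in D} ->
    {in E &, forall r q, Q r q = R (G r) (G q)} ->
    {in D, forall C, exists2 r, r \in E & R C (G r)} ->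
  exists f : {X | X \in equivalence_partition R D} ->
             {Y | Y \in equivalence_partition Q E},
    bijective f /\
    forall X r, r \in sval (f X) -> r \in E /\ G r \in sval X.
Proof.
move=> Req GE QR surj.
have Rxx x : R x x by case: (Req x x x).
have Rl x y z : R x y -> R x z = R y z by case: (Req x y z).
have FE C r : r \in E -> R C (G r) ->
    [set q in E | G q \in [set D0 in D | R C D0]] = [set q in E | Q r q].
  move=> rE CGr; apply/setP=> q; rewrite !inE; case: (boolP (q \in E)) => //= qE.
  by rewrite GE //= QR // (Rl _ _ _ CGr).
have FP X : X \in equivalence_partition R D ->
    [set q in E | G q \in X] \in equivalence_partition Q E.
  case/imsetP=> C /surj[r rE CGr] ->; rewrite (FE _ _ rE CGr).
  exact: imset_f.
pose f (X : {X | X \in equivalence_partition R D}) :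
  {Y | Y \in equivalence_partition Q E} :=
  exist (fun Y => is_true (Y \in _)) _ (FP _ (svalP X)).
have f_inj : injective f.
  move=> X X' eqf; have {eqf} eqF : sval (f X) = sval (f X') by rewrite eqf.
  apply: val_inj; move: eqF; rewrite /f /=.
  case/imsetP: (svalP X) => C CD; case/imsetP: (svalP X') => C' CD' -> -> eqF.
  (* Some [G r] lies in [X]. Equal preimages put it in [X'] as well, and two classes with a common
     element coincide. *)
  have [r rE CGr] := surj _ CD.
  have: r \in [set q in E | G q \in [set D0 in D | R C D0]].
    by rewrite !inE rE GE.
  rewrite eqF !inE rE GE //= => C'Gr.
  by apply/setP=> D0; rewrite !inE (Rl _ _ _ CGr) (Rl _ _ _ C'Gr).
have f_surj Y : exists X, f X == Y.
  case/imsetP: (svalP Y) => r rE eqY.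
  have XP : [set D0 in D | R (G r) D0] \in equivalence_partition R D.
    by apply: imset_f; exact: GE.
  exists (exist (fun X => is_true (X \in _)) _ XP); rewrite -val_eqE /= (FE _ r) //.
  by rewrite eqY.
exists f; split; last by move=> X r; rewrite /f /= inE => /andP[].
have fK Y : f (xchoose (f_surj Y)) = Y by exact/eqP/(xchooseP (f_surj Y)).
by exists (fun Y => xchoose (f_surj Y)) => // X; apply: f_inj; rewrite fK.
Qed.

(** * Exchanging two transversals *)

(** [A] and [B] each have exactly one point in the same fibres of [m]. Swapping these two points in
    every such fibre, and fixing everything else, is the required permutation. *)
Lemma perm_exchange_transversals (V : finType) (K : eqType) (m : V -> K)
    (A B : {set V}) :
    {in A &, injective m} -> {in B &, injective m} ->
    {in A, forall a, exists2 b, b \in B & m b = m a} ->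
    {in B, forall b, exists2 a, a \in A & m a = m b} ->
  exists t : {perm V},
    (forall x, m (t x) = m x) /\ (forall x, (t x \in B) = (x \in A)).
Proof.
move=> injA injB AB BA.
(* The point of [E] in the fibre of [y], or [y] itself when that fibre misses [E]. *)
pose f (E : {set V}) y := odflt y [pick x in E | m x == m y].
have mf E y : m (f E y) = m y.
  by rewrite /f; case: pickP => //= x /andP[_ /eqP].
have f_in (E : {set V}) y x : x \in E -> m x = m y -> f E y \in E.
  move=> xE mxy; rewrite /f; case: pickP => /= [z /andP[]// | /(_ x)].
  by rewrite xE mxy eqxx.
have f_id (E : {set V}) y : {in E &, injective m} -> y \in E -> f E y = y.
  by move=> injE yE; apply: injE; rewrite ?mf ?(f_in _ _ y).
have f_eq (E : {set V}) y z : {in E &, injective m} -> m y = m z ->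
    (exists2 x, x \in E & m x = m y) -> f E y = f E z.
  move=> injE myz [x xE mxy].
  by apply: injE; rewrite ?mf // (f_in _ _ x) // mxy.
have f_out (E : {set V}) y : ~ (exists2 x, x \in E & m x = m y) -> f E y = y.
  move=> nE; rewrite /f; case: pickP => //= x /andP[xE /eqP mxy].
  by case: nE; exists x.
pose hit (E : {set V}) y := [exists x in E, m x == m y].
have hitP (E : {set V}) y : reflect (exists2 x, x \in E & m x = m y) (hit E y).
  by apply: (iffP exists_inP) => -[x xE mxy]; exists x => //; exact/eqP.
have hitAB y : hit A y = hit B y.
  by apply/hitP/hitP => -[x xE <-]; [exact: AB | exact: BA].
pose t y := tperm (f A y) (f B y) y.
have mt y : m (t y) = m y by rewrite /t; case: tpermP => // ->; rewrite !mf.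
(* Since [t] stays inside the fibre, the same transposition is applied at [y] and at [t y]; hence
   [t] is an involution. *)
have ft y : f A (t y) = f A y /\ f B (t y) = f B y.
  have [hA|/negP hA] := boolP (hit A y).
    have hB := hA; rewrite hitAB in hB.
    by split; apply: f_eq => //; rewrite mt; exact/hitP.
  have hB := hA; rewrite hitAB in hB.
  suff ->: t y = y by [].
  by rewrite /t !f_out ?tpermL // => /hitP.
have tK : involutive t.
  by move=> y; rewrite {1}/t; have [-> ->] := ft y; rewrite tpermK.
exists (perm (inv_inj tK)); split=> x; rewrite permE //.
apply/idP/idP => [txB|xA].
  have eq_tx : f B x = t x by have [_ <-] := ft x; rewrite f_id.
  have: x = f A x.
    by rewrite -[LHS]tK {1}/t; have [-> ->] := ft x; rewrite -eq_tx tpermR.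
  move=> ->; have [a aA ma] := BA _ txB.
  by apply: (f_in _ _ a) => //; rewrite ma mt.
have [b bB mb] := AB _ xA.
by rewrite /t (f_id A) // tpermL (f_in _ _ b).
Qed.

(** * Up-set covers and relabelling *)

Section UpsetCover.
Variable V : finType.
Implicit Types (r q : {set V * V}) (C : {set {set V}}) (s : {perm V}).

Definition upset r x : {set V} := [set y | ple r x y].
Definition upset_cover r : {set {set V}} :=
  [set upset r x | x in [set x | height0 r x]].
(** Turns an isomorphism into an equality of relations, as [poset_isoP] makes precise. *)
Definition poset_pullback s q : {set V * V} := [set p | ple q (s p.1) (s p.2)].

(* Every strict relation starting at height 0 already forces antisymmetry and
   transitivity. *)
Lemma bipartite_posetP r :
  reflect (reflexive (ple r) /\ forall x y, plt r x y -> height0 r x)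
          (is_bipartite_poset r).
Proof.
apply: (iffP andP) => [[/is_posetP[rxx _ _] nchain]|[rxx h0]]; split=> //.
- move=> x y xy; apply/existsP=> -[u ux]; case/negP: nchain.
  by apply/existsP; exists u; apply/'exists_existsP; exists x, y; rewrite ux.
- apply/is_posetP; split=> // [x y /andP[xy yx]|y x z xy yz].
    apply/eqP/negPn/negP=> nxy.
    have /h0/negP[] : plt r x y by rewrite /plt nxy.
    by apply/existsP; exists y; rewrite /plt eq_sym nxy.
  have [->//|nyz] := eqVneq x y; have [<-//|nxz] := eqVneq y z.
  have /h0/negP[] : plt r y z by rewrite /plt nxz.
  by apply/existsP; exists x; rewrite /plt nyz.
apply/existsP=> -[x] /'exists_existsP[y [z /andP[xy /h0/negP[]]]].
by apply/existsP; exists x.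
Qed.

Lemma height0_min r x y : height0 r x -> ple r y x -> y = x.
Proof.
move=> /negP hx yx; apply/eqP/negPn/negP=> nyx; apply: hx.
by apply/existsP; exists y; rewrite /plt nyx.
Qed.

Lemma pullback_ple s q x y : ple (poset_pullback s q) x y = ple q (s x) (s y).
Proof. by rewrite /ple !inE. Qed.

Lemma pullback_plt s q x y : plt (poset_pullback s q) x y = plt q (s x) (s y).
Proof. by rewrite /plt pullback_ple (inj_eq perm_inj). Qed.

Lemma pullback_height0 s q x :
  height0 (poset_pullback s q) x = height0 q (s x).
Proof.
congr negb; apply/existsP/existsP=> -[u ux].
  by exists (s u); rewrite -pullback_plt.
by exists (s^-1 u)%g; rewrite pullback_plt permKV.
Qed.

Lemma pullback_bipartite s q :
  is_bipartite_poset q -> is_bipartite_poset (poset_pullback s q).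
Proof.
move=> /bipartite_posetP[qxx h0]; apply/bipartite_posetP; split=> [x|x y].
  by rewrite pullback_ple.
by rewrite pullback_plt pullback_height0; exact: h0.
Qed.

Lemma poset_isoP r q :
  reflect (exists s, r = poset_pullback s q) (poset_iso r q).
Proof.
apply: (iffP existsP) => -[s].
  move=> /'forall_forallP rq; exists s; apply/setP=> -[x y].
  by rewrite inE -(eqP (rq x y)).
by move=> ->; exists s; apply/'forall_forallP=> x y; rewrite pullback_ple.
Qed.

Lemma pullback_upset s q x : s @: upset (poset_pullback s q) x = upset q (s x).
Proof.
apply/setP=> y; rewrite -(permKV s y) mem_imset; last exact: perm_inj.
by rewrite !inE pullback_ple.
Qed.

Lemma pullback_upset_cover s q :
  [set s @: S | S : {set V} in upset_cover (poset_pullback s q)] = upset_cover q.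
Proof.
apply/setP=> S; apply/imsetP/imsetP.
  case=> S' /imsetP[x]; rewrite inE pullback_height0 => hx -> ->.
  by exists (s x); rewrite ?inE // pullback_upset.
case=> x; rewrite inE -{1}(permKV s x) -pullback_height0 => hx ->.
exists (upset (poset_pullback s q) (s^-1 x)%g); last by rewrite pullback_upset permKV.
by apply: imset_f; rewrite inE.
Qed.

(** * The up-set cover of a fixed bipartite poset *)

Section Bipartite.
Variable r : {set V * V}.
Hypothesis bip_r : is_bipartite_poset r.

Lemma bipartite_refl x : ple r x x.
Proof. by case/bipartite_posetP: bip_r. Qed.

(** The height-0 points and their up-sets determine the order; this is how posets with the same
    cover get compared. *)
Lemma bipartite_pleE x y :
  ple r x y = (x == y) || height0 r x && (y \in upset r x).
Proof.
rewrite inE; have [->|nxy] := eqVneq x y; first by rewrite bipartite_refl.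
apply/idP/andP=> [xy|[]//]; split=> //.
by have [_ h0] := bipartite_posetP _ bip_r; apply: (h0 x y); rewrite /plt nxy.
Qed.

Lemma bipartite_height0_below y : exists2 x, height0 r x & ple r x y.
Proof.
have [h0y|] := boolP (height0 r y); first by exists y; rewrite ?bipartite_refl.
rewrite negbK => /existsP[u uy]; exists u; last by case/andP: uy.
by have [_ h0] := bipartite_posetP _ bip_r; apply: h0 uy.
Qed.

Lemma upset_inj : {in [set x | height0 r x] &, injective (upset r)}.
Proof.
move=> x y; rewrite !inE => hx hy eq_up; apply: (height0_min hy).
by have := bipartite_refl y; rewrite -[ple r y y]inE -/(upset r y) -eq_up inE.
Qed.

(** A member containing [x] is the up-set of some height-0 point below [x], which can only be [x].
    So [x] is a private point, and the members through it identify its up-set. *)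
Lemma upset_cover_height0 x : height0 r x ->
  [set S in upset_cover r | x \in S] = [set upset r x].
Proof.
move=> hx; apply/setP=> S; rewrite !inE; apply/andP/eqP=> [[]|->].
  by case/imsetP=> y _ ->; rewrite inE => /(height0_min hx) ->.
by rewrite imset_f ?inE ?bipartite_refl.
Qed.

Lemma upset_cover_min : is_min_cover (upset_cover r).
Proof.
apply/andP; split.
  apply/eqP/setP=> y; rewrite inE; apply/bigcupP.
  have [x hx xy] := bipartite_height0_below y.
  by exists (upset r x); [apply: imset_f | ]; rewrite inE.
apply/forall_inP=> S /imsetP[x]; rewrite inE => hx ->; apply/negP.
move=> /subsetP/(_ x); rewrite inE bipartite_refl => /(_ isT) /bigcupP[S'].
rewrite !inE => /andP[neq S'C] xS'.
have: S' \in [set upset r x] by rewrite -upset_cover_height0 // inE S'C.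
by rewrite inE (negPf neq).
Qed.

(** Every point strictly above [x] has height 1, so [x] is the only height-0 point of its up-set. *)
Lemma card_upset x : height0 r x ->
  #|upset r x| = #|upset r x :&: [set v | height1 r v]|.+1.
Proof.
move=> hx; rewrite [LHS](cardsD1 x) inE bipartite_refl add1n; congr _.+1.
apply: eq_card => y; rewrite !inE; have [->|nyx] /= := eqVneq y x.
  by rewrite -[height1 r x]negbK -/(height0 r x) hx andbF.
rewrite andbC; case xy: (ple r x y); rewrite ?andbF ?andbT //=.
by apply/esym/existsP; exists x; rewrite /plt eq_sym nyx.
Qed.

Lemma upset_cover_unbalanced :
  cover_unbalanced (upset_cover r) = poset_unbalanced r.
Proof.
have cardV : #|[set x | height0 r x]| + #|[set x | height1 r x]| = #|V|.
  rewrite -(cardsC [set x | height0 r x]); congr (_ + _); apply: eq_card => x.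
  by rewrite !inE negbK.
have key x : height0 r x ->
    (#|upset r x| + #|upset_cover r| == #|V| + 1) = full_support_point r x.
  move=> hx; rewrite /full_support_point hx card_upset // (card_in_imset upset_inj).
  rewrite -cardV addSn addn1 eqSS addnC eqn_add2l.
  (* After cancelling the height-0 points, the count says that the height-1 points above [x] are as
     many as all height-1 points, so the two sets are equal. *)
  have [_ ->] := subset_leqif_cards (subsetIr (upset r x) [set v | height1 r v]).
  apply/eqP/forallP => [/setIidPr/subsetP sub v|sub].
    by apply/implyP=> hv; have := sub v; rewrite !inE hv => ->.
  apply/setIidPr/subsetP=> v; rewrite !inE => hv.
  have /orP[//|vx] := implyP (sub v) hv.
  by rewrite (height0_min hx vx) bipartite_refl.
apply/exists_inP/existsP=> [[S /imsetP[x]]|[x fx]].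
  by rewrite inE => hx ->; rewrite key // => fx; exists x.
have hx : height0 r x by case/andP: fx.
by exists (upset r x); rewrite ?key // imset_f ?inE.
Qed.

End Bipartite.

(** * Isomorphic covers come from isomorphic posets *)

(** The height-0 points of [r] and of [q] are two choices of private points for one cover. The
    isomorphism is a permutation that exchanges them and keeps each point in the same members. *)
Lemma upset_cover_eq_iso r q :
  is_bipartite_poset r -> is_bipartite_poset q ->
  upset_cover r = upset_cover q -> poset_iso r q.
Proof.
move=> br bq eqC.
pose m y := [set S in upset_cover r | y \in S].
have mr x : height0 r x -> m x = [set upset r x] by exact: upset_cover_height0.
have mq x : height0 q x -> m x = [set upset q x].
  by rewrite /m eqC; exact: upset_cover_height0.
have [t [mt tB]] : exists t : {perm V}, (forall x, m (t x) = m x) /\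
    (forall x, (t x \in [set x | height0 q x]) = (x \in [set x | height0 r x])).
  apply: perm_exchange_transversals.
  - move=> x y xA yA; rewrite !mr; [|by rewrite inE in yA|by rewrite inE in xA].
    by move/set1_inj/(upset_inj br); apply.
  - move=> x y xA yA; rewrite !mq; [|by rewrite inE in yA|by rewrite inE in xA].
    by move/set1_inj/(upset_inj bq); apply.
  - move=> x xA; have /imsetP[y yB eq_up] : upset r x \in upset_cover q.
      by rewrite -eqC imset_f.
    by exists y => //; rewrite !inE in xA yB; rewrite (mq y) // (mr x) // eq_up.
  - move=> x xA; have /imsetP[y yB eq_up] : upset q x \in upset_cover r.
      by rewrite eqC imset_f.
    by exists y => //; rewrite !inE in xA yB; rewrite (mr y) // (mq x) // eq_up.
have memt x S : S \in upset_cover r -> (t x \in S) = (x \in S).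
  by move=> SC; have := mt x; move/setP/(_ S); rewrite !inE SC.
apply/existsP; exists t; apply/'forall_forallP=> x y; apply/eqP.
rewrite (bipartite_pleE br) (bipartite_pleE bq) (inj_eq perm_inj).
have := tB x; rewrite !inE => ->; congr orb.
case hx: (height0 r x) => //=.
have htx : height0 q (t x) by have := tB x; rewrite !inE hx.
have /set1_inj eq_up : [set upset r x] = [set upset q (t x)].
  by rewrite -mr // -mq.
by rewrite -[in RHS]inE -/(upset q (t x)) -eq_up memt ?inE // imset_f ?inE.
Qed.

(** Pulling [q] back along the isomorphism of covers reduces the converse direction to the case of
    equal covers. *)
Lemma upset_cover_iso r q :
  is_bipartite_poset r -> is_bipartite_poset q ->
  poset_iso r q = cover_iso (upset_cover r) (upset_cover q).
Proof.
move=> br bq; apply/poset_isoP/existsP=> [[s ->]|[s /eqP eqC]].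
  by exists s; rewrite pullback_upset_cover.
have bp := pullback_bipartite s bq.
have: upset_cover r = upset_cover (poset_pullback s q).
  apply: (imset_inj (imset_inj (@perm_inj _ s))).
  by rewrite -eqC pullback_upset_cover.
move/(upset_cover_eq_iso br bp)/poset_isoP=> [t ->]; exists (t * s)%g.
by apply/setP=> -[x y]; rewrite !inE pullback_ple !permM.
Qed.

(** * Every minimal cover is an up-set cover *)

Lemma min_cover_upset_cover C : is_min_cover C ->
  exists2 r, is_bipartite_poset r & upset_cover r = C.
Proof.
case/andP=> /eqP covC /forall_inP minC.
(* A private point of [S]; minimality excludes [None] when [S] is a member. *)
pose h S := [pick x in S :\: cover (C :\ S)].
have h_ex S : S \in C -> exists x, h S = Some x.
  move=> SC; rewrite /h; case: pickP => [x _|h0]; first by exists x.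
  case/negP: (minC S SC); apply/subsetP=> x xS.
  by have := h0 x; rewrite !inE xS andbT => /negbFE.
have h_in S x : h S = Some x -> x \in S.
  by rewrite /h; case: pickP => // y; rewrite inE => /andP[_ yS] [<-].
have h_priv S S' x : h S = Some x -> S' \in C -> x \in S' -> S' = S.
  rewrite /h; case: pickP => // y; rewrite inE => /andP[/negP nyC _] [<-] S'C yS'.
  apply/eqP/negPn/negP=> neq; apply: nyC; apply/bigcupP; exists S' => //.
  by rewrite !inE neq.
pose r : {set V * V} := [set p | (p.1 == p.2) ||
  [exists S in C, (h S == Some p.1) && (p.2 \in S)]].
have rP x y : ple r x y =
    (x == y) || [exists S in C, (h S == Some x) && (y \in S)].
  by rewrite /ple inE.
(* A point strictly below [x] would be the chosen point of a member containing [x]; that member is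
   [S], whose chosen point is [x] itself. *)
have h_height0 S x : h S = Some x -> S \in C -> height0 r x.
  move=> hS SC; apply/existsP=> -[u /andP[nux]]; rewrite rP (negPf nux) /=.
  case/exists_inP=> S' S'C /andP[/eqP hS' xS'].
  rewrite (h_priv _ _ _ hS S'C xS') hS in hS'.
  by case: hS' nux => ->; rewrite eqxx.
have up_h S x : h S = Some x -> S \in C -> upset r x = S.
  move=> hS SC; apply/setP=> y; rewrite inE rP; apply/orP/idP.
    case=> [/eqP <-|]; first exact: h_in hS.
    case/exists_inP=> S' S'C /andP[/eqP hS'].
    by rewrite (h_priv _ _ _ hS S'C (h_in _ _ hS')).
  by move=> yS; right; apply/exists_inP; exists S => //; rewrite hS eqxx.
exists r.
  apply/bipartite_posetP; split=> [x|x y /andP[nxy]]; first by rewrite rP eqxx.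
  rewrite rP (negPf nxy) /= => /exists_inP[S SC /andP[/eqP hS _]].
  exact: h_height0 hS SC.
apply/setP=> S; apply/imsetP/idP=> [[x]|SC].
  rewrite inE => hx ->.
  have /bigcupP[S' S'C xS'] : x \in cover C by rewrite covC inE.
  have [z hS'] := h_ex _ S'C.
  (* The chosen point [z] of a member through [x] lies below [x], so minimality of [x] gives
     [z = x]: only chosen points have height 0, and no extra up-sets arise. *)
  have zx : z = x.
    by apply: (height0_min hx); rewrite -[ple _ _ _]inE -/(upset r z) (up_h S').
  by rewrite -zx (up_h S').
have [x hS] := h_ex _ SC.
by exists x; rewrite ?(up_h _ _ hS) // inE (h_height0 S).
Qed.

Lemma cover_iso_unbalanced C D :
  cover_iso C D -> cover_unbalanced D = cover_unbalanced C.
Proof.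
case/existsP=> s /eqP->; have s_inj := @perm_inj _ s.
rewrite /cover_unbalanced (card_imset _ (imset_inj s_inj)).
apply/exists_inP/exists_inP=> [[S' /imsetP[S SC ->]]|[S SC]] eqn.
  by exists S => //; rewrite (card_imset _ s_inj) in eqn.
by exists (s @: S); rewrite ?imset_f // (card_imset _ s_inj).
Qed.

End UpsetCover.

Theorem theorem5p1 (n : nat) :
  exists f : {X | X \in min_cover_classes 'I_n} ->
             {Y | Y \in bipartite_poset_classes 'I_n},
    bijective f /\
    (forall (X : {X | X \in min_cover_classes 'I_n})
            (C : {set {set 'I_n}}) (r : {set 'I_n * 'I_n}),
        C \in sval X -> r \in sval (f X) ->
        (cover_unbalanced C -> poset_unbalanced r) /\
        (cover_balanced C -> poset_balanced r)).
Proof.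
have [|r|r q|C|f [f_bij fP]] := @equivalence_partition_bij _ _
    (@cover_iso 'I_n) (@poset_iso 'I_n) [set C | is_min_cover C]
    [set r | is_bipartite_poset r] (@upset_cover 'I_n).
- exact: cover_iso_equiv.
- by rewrite !inE; exact: upset_cover_min.
- by rewrite !inE; exact: upset_cover_iso.
- rewrite inE => /min_cover_upset_cover[r br eqC]; exists r; rewrite ?inE //.
  by rewrite eqC; case: (cover_iso_equiv C C C).
exists f; split=> // X C r CX /fP[]; rewrite inE => br GrX.
suff eqU : cover_unbalanced C = poset_unbalanced r.
  by rewrite /cover_balanced /poset_balanced eqU.
(* [C] and the cover of [r] both lie in the class [X], hence are isomorphic. *)
rewrite -upset_cover_unbalanced //; apply: cover_iso_unbalanced.
case/imsetP: (svalP X) CX GrX => D _ ->; rewrite !inE => /andP[_ DC] /andP[_ DG].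
by have [_ <-] := cover_iso_equiv D (upset_cover r) C; last by [].
Qed.
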